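(* There is a universal constant $c$ such that the following holds. Let $n\ge 2$ and $m>k\ge 1$ be integers. Suppose $G$ is any $n$-processor $\mathsf{BCAST}(1)$ protocol in which each processor starts with a seed of $k$ private, independent, uniform random bits (and no other randomness) and at the end holds a string of $m$ output bits. Then there is a $\mathsf{BCAST}(1)$ protocol with at most $ck$ rounds that breaks $G$ as a pseudo-random generator.
   Context: **Model.** In the $\mathsf{BCAST}(1)$ (Broadcast Congested Clique) model there are $n$ processors numbered $1,\dots,n$, each holding a private input string and having unlimited computational power. Computation proceeds in synchronous rounds; in each round every processor broadcasts a single bit (the same bit to all processors), which may depend on its index, its input, its random bits and all bits broadcast in previous rounds. The transcript is the list of all broadcast bits, together with sender and round. **Breaking.** A $\mathsf{BCAST}(1)$ protocol $\Pi$, with $n$ processors each having an $m$-bit input, breaks $G$ if the statistical distance between the distribution of the transcript of $\Pi$ when the inputs are the $n$ output strings of $G$ (run on uniform seeds) and the distribution of the transcript of $\Pi$ when the inputs are independent and uniform in $\{0,1\}^m$ is greater than $1/n$. Statistical distance is $\|\mathcal{D}_1-\mathcal{D}_2\|=\frac12\sum_x|\mathcal{D}_1(x)-\mathcal{D}_2(x)|$. *)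

(* Defs.v *)
From HB Require Import structures.
From mathcomp Require Import all_boot all_order all_algebra.

Set Implicit Arguments.
Unset Strict Implicit.
Unset Printing Implicit Defensive.

Import Order.TTheory GRing.Theory Num.Theory.

Local Open Scope ring_scope.

Definition bits (l : nat) := l.-tuple bool.

(* The bits broadcast in one round, indexed by the sender. *)
Definition round_bits (n : nat) := {ffun 'I_n -> bool}.

(* A BCAST(1) protocol with n processors, m-bit private inputs and r private
   random bits per processor.  The list passed to [bcast] holds the rounds
   already played, oldest first, so its size is the index of the current
   round. *)
Record protocol (n m r : nat) := Protocol {
  rounds : nat;
  bcast : 'I_n -> bits m -> bits r -> seq (round_bits n) -> bool
}.

Section Execution.
Variables (n m r : nat) (P : protocol n m r).
Variables (x : {ffun 'I_n -> bits m}) (rho : {ffun 'I_n -> bits r}).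

Fixpoint history (t : nat) : seq (round_bits n) :=
  if t is t'.+1 then
    let h := history t' in rcons h [ffun i => bcast P i (x i) (rho i) h]
  else [::].

Lemma size_history t : size (history t) == t.
Proof. by elim: t => //= t /eqP IHt; rewrite size_rcons IHt. Qed.

(* Entry t, applied to i, is the bit sent by processor i in round t. *)
Definition transcript : (rounds P).-tuple (round_bits n) :=
  Tuple (size_history (rounds P)).
End Execution.

(* A protocol without inputs whose only randomness is a k-bit seed per
   processor; each processor finally computes m output bits from its index, its
   seed and everything that was broadcast. *)
Record generator (n k m : nat) := Generator {
  gen_protocol : protocol n 0 k;
  gen_output : 'I_n -> bits k ->
    (rounds gen_protocol).-tuple (round_bits n) -> bits m
}.

Definition outputs (n k m : nat) (G : generator n k m)
    (s : {ffun 'I_n -> bits k}) : {ffun 'I_n -> bits m} :=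
  let tr := transcript (gen_protocol G) [ffun=> [tuple]] s in
  [ffun i => gen_output i (s i) tr].

(* Probability mass function of f(w) for w uniform in W; the probabilities are
   rational since all randomness consists of finitely many fair bits. *)
Definition law (W T : finType) (f : W -> T) : {ffun T -> rat} :=
  [ffun t => #|[set w | f w == t]|%:R / #|W|%:R].

Definition stat_dist (T : finType) (D1 D2 : {ffun T -> rat}) : rat :=
  2^-1 * \sum_(t : T) `|D1 t - D2 t|.

Definition transcript_law_gen (n k m r : nat) (P : protocol n m r)
    (G : generator n k m) :=
  law (fun w : {ffun 'I_n -> bits k} * {ffun 'I_n -> bits r} =>
         transcript P (outputs G w.1) w.2).

Definition transcript_law_unif (n m r : nat) (P : protocol n m r) :=
  law (fun w : {ffun 'I_n -> bits m} * {ffun 'I_n -> bits r} =>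
         transcript P w.1 w.2).

Definition breaks (n k m r : nat) (P : protocol n m r) (G : generator n k m) :=
  n%:R^-1 < stat_dist (transcript_law_gen P G) (transcript_law_unif P).

(* Main.v *)
(** Let every processor broadcast the first [k + 1 <= 2 * k] bits of its input.
    On outputs of [G] the transcript is a function of the [n * k] seed bits, so
    it lies in a set of at most [2 ^ (n * k)] transcripts; on uniform inputs it
    is uniform over [2 ^ (n * (k + 1))] transcripts and hits that set with
    probability at most [2 ^- n].  The distance is thus at least [1 - 2 ^- n],
    which exceeds [1 / n]. *)
Require Import Defs.
From mathcomp Require Import all_boot all_order all_algebra.
From mathcomp Require Import zify lra.

Set Implicit Arguments.
Unset Strict Implicit.
Unset Printing Implicit Defensive.

Import Order.TTheory GRing.Theory Num.Theory.

Lemma sum_law (W T : finType) (f : W -> T) (A : {set T}) :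
  (\sum_(t in A) law f t = #|f @^-1: A|%:R / #|W|%:R)%R.
Proof.
under eq_bigr do rewrite ffunE.
rewrite -mulr_suml -natr_sum; congr (_%:R / _)%R.
rewrite -sum1_card (partition_big f (mem A)) /=; last by move=> w; rewrite inE.
apply: eq_bigr => t tA; rewrite -sum1_card; apply: eq_bigl => w.
by rewrite !inE; case: eqP => [->|]; rewrite ?tA ?andbF.
Qed.

Lemma sum_law_total (W T : finType) (f : W -> T) :
  0 < #|W| -> (\sum_t law f t = 1)%R.
Proof.
move=> W_gt0; rewrite -(eq_bigl _ _ (@in_setT T)) sum_law preimsetT cardsT divff //.
by rewrite pnatr_eq0 -lt0n.
Qed.

(** Since the total masses agree, the excess of [D1] on [A] equals its deficit off [A]. Each bounds
    its own part of the sum of absolute differences, and this doubling cancels the factor 1/2. *)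
Lemma stat_dist_event (T : finType) (D1 D2 : {ffun T -> rat}) (A : {set T}) :
  (\sum_t D1 t = \sum_t D2 t ->
   \sum_(t in A) D1 t - \sum_(t in A) D2 t <= stat_dist D1 D2)%R.
Proof.
rewrite /stat_dist !(bigID (mem A) predT) /= => eqD.
have leA : (\sum_(t in A) D1 t - \sum_(t in A) D2 t
            <= \sum_(t in A) `|D1 t - D2 t|)%R.
  by rewrite -sumrB; apply: ler_sum => t _; apply: ler_norm.
have leAC : (\sum_(t | t \notin A) D2 t - \sum_(t | t \notin A) D1 t
             <= \sum_(t | t \notin A) `|D1 t - D2 t|)%R.
  rewrite -sumrB; apply: ler_sum => t _.
  by rewrite distrC; apply: ler_norm.
lra.
Qed.

(** The distinguishing event is the image of [f]: it has mass 1 under [law f], and it consists of at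
    most [#|W1|] points, each with at most [b] preimages under [g]. *)
Lemma stat_dist_law_ge (W1 W2 T : finType) (f : W1 -> T) (g : W2 -> T) b :
  0 < #|W1| -> 0 < #|W2| ->
  (forall t, #|[set w | g w == t]| <= b) ->
  (1 - (#|W1| * b)%:R / #|W2|%:R <= stat_dist (law f) (law g))%R.
Proof.
move=> W1_gt0 W2_gt0 fibre_le; pose A := [set f w | w in W1].
apply: le_trans (@stat_dist_event _ _ _ A _); last first.
  by rewrite !sum_law_total.
have -> : (\sum_(t in A) law f t = 1)%R.
  rewrite sum_law (_ : f @^-1: A = setT) ?cardsT ?divff ?pnatr_eq0 -?lt0n //.
  by apply/setP => w; rewrite !inE imset_f.
rewrite lerD2l lerN2.
under eq_bigr do rewrite ffunE.
rewrite -mulr_suml -natr_sum ler_wpM2r ?invr_ge0 ?ler0n // ler_nat.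
apply: (@leq_trans (\sum_(t in A) b)); first by apply: leq_sum.
by rewrite sum_nat_const leq_mul2r leq_imset_card orbT.
Qed.

Lemma nth_history n m r (P : protocol n m r) x rho h0 t j : j < t ->
  nth h0 (history P x rho t) j =
  [ffun i => bcast P i (x i) (rho i) (history P x rho j)].
Proof.
elim: t => // t IHt; rewrite ltnS leq_eqVlt nth_rcons.
rewrite (eqP (size_history P x rho t)) => /predU1P[->|lt_jt].
  by rewrite ltnn eqxx.
by rewrite lt_jt IHt.
Qed.

(** The length of the history is the index of the current round, so round [j] sends bit [j] of the
    input; the default [false] is reached only in rounds [j >= m]. *)
Definition prefix_protocol n m q : protocol n m 0 :=
  Protocol q (fun _ x _ h => nth false x (size h)).

Lemma prefix_transcript_inj n m q (x y : {ffun 'I_n -> bits m}) rho sigma :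
  transcript (prefix_protocol n m q) x rho =
    transcript (prefix_protocol n m q) y sigma ->
  forall i j, j < q -> nth false (x i) j = nth false (y i) j.
Proof.
move=> /(congr1 val) /= eq_hist i j lt_jq.
have := congr1 (fun h : seq (round_bits n) => nth [ffun=> false] h j i) eq_hist.
by rewrite !nth_history // !ffunE /= !(eqP (size_history _ _ _ _)).
Qed.

Lemma card_bits_family n l : #|{ffun 'I_n -> bits l}| = 2 ^ (l * n).
Proof. by rewrite card_ffun card_tuple card_bool card_ord expnM. Qed.

(** The transcript fixes the first [q] bits of every input, so mapping each input to its remaining
    [m - q] bits is injective on a fibre; the random strings are empty. *)
Lemma card_prefix_fibre n m q t : q <= m ->
  #|[set w : {ffun 'I_n -> bits m} * {ffun 'I_n -> bits 0} |
      transcript (prefix_protocol n m q) w.1 w.2 == t]| <= 2 ^ ((m - q) * n).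
Proof.
move=> le_qm; rewrite -card_bits_family.
pose suffix (w : {ffun 'I_n -> bits m} * {ffun 'I_n -> bits 0}) :=
  [ffun i => [tuple of drop q (w.1 i)]] : {ffun 'I_n -> bits (m - q)}.
apply: (@leq_card_in _ _ suffix) => // -[x rho] [y sigma].
rewrite !inE /= => /eqP <- /eqP/esym/prefix_transcript_inj eq_prefix eq_suffix.
congr pair; apply/ffunP => i; last by rewrite (tuple0 (rho i)) (tuple0 (sigma i)).
apply/val_inj/(@eq_from_nth _ false); rewrite ?size_tuple // => j _.
case: (ltnP j q) => [lt_jq|le_qj]; first exact: eq_prefix.
have /ffunP/(_ i) := eq_suffix; rewrite !ffunE => /(congr1 val) /= eq_drop.
by rewrite -(subnKC le_qj) -!nth_drop eq_drop.
Qed.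

Lemma prefix_protocol_stat_dist n m k (G : generator n k m) : k < m ->
  (1 - (2 ^+ n)^-1 <=
   stat_dist (transcript_law_gen (prefix_protocol n m k.+1) G)
             (transcript_law_unif (prefix_protocol n m k.+1)))%R.
Proof.
move=> lt_km; set P := prefix_protocol n m k.+1.
have card_inputs l :
    #|{: {ffun 'I_n -> bits l} * {ffun 'I_n -> bits 0}}| = 2 ^ (l * n).
  by rewrite card_prod !card_bits_family mul0n muln1.
have := @stat_dist_law_ge _ _ _
  (fun w => transcript P (outputs G w.1) w.2) (fun w => transcript P w.1 w.2)
  (2 ^ ((m - k.+1) * n)).
rewrite !card_inputs !expn_gt0 => /(_ isT isT).
move=> /(_ (fun t => card_prefix_fibre t lt_km)).
apply: le_trans; rewrite lerD2l lerN2 -expnD.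
(* The seeds and the fibre bound account for the first two summands, which cancel and leave
   [2 ^- n]. *)
have -> : m * n = k * n + (m - k.+1) * n + n by rewrite -mulnDl; nia.
rewrite (expnD _ _ n) natrM invfM mulrA divff ?mul1r ?natrX //.
by rewrite expf_neq0.
Qed.

Theorem theorem8p1 :
  exists c : nat,
  forall (n m k : nat), 2 <= n -> 1 <= k -> k < m ->
  forall G : generator n k m,
  exists (r : nat) (P : protocol n m r),
    rounds P <= c * k /\ breaks P G.
Proof.
exists 2 => n m k n_ge2 k_ge1 lt_km G.
exists 0, (prefix_protocol n m k.+1); split; first by rewrite /=; lia.
apply: lt_le_trans (prefix_protocol_stat_dist G lt_km).
(* For [n >= 2] the gap is 1/n <= 1/2 < 3/4 <= 1 - 2^-n. *)
have inv_n : (n%:R^-1 <= 2^-1 :> rat)%R.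
  by rewrite lef_pV2 ?posrE ?ltr0n ?ler_nat // ltnW.
have inv_2n : ((2 ^+ n)^-1 <= (2 ^+ 2)^-1 :> rat)%R.
  by rewrite lef_pV2 ?posrE ?exprn_gt0 // ler_eXn2l.
lra.
Qed.
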